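(* Consider the problem (MF) $$\min_{\hat{\mathbf x}_i,\, i\in\mathcal V}\ \sum_{i\in\mathcal V}\Phi_i(\hat{\mathbf x}_i)\quad\text{s.t.}\quad \mathbf A_i\hat{\mathbf x}_i\le \mathbf a_i,\qquad \mathbf B_{ii}\hat{\mathbf x}_i+\sum_{j\in\mathcal N_i}\mathbf B_{ji}\hat{\mathbf x}_j\le \mathbf b_i,\qquad \forall i\in\mathcal V,$$ of the microgrid network, with all data and standing assumptions as specified in the context, and let $\Psi(\hat{\boldsymbol\eta})=\min_{\hat{\mathbf x}}\mathcal L(\hat{\mathbf x},\hat{\boldsymbol\eta})$ be its dual function. Let $L_\Psi>0$ be a Lipschitz constant of $\nabla\Psi$. From any initial point $\boldsymbol\eta(0)$, define the sequence $\boldsymbol\eta(s)=\mathrm{col}\{\boldsymbol\lambda_i(s),\boldsymbol\zeta_i(s): i\in\mathcal V\}$, $s=0,1,2,\dots$, by, for all $i\in\mathcal V$, $$\mathbf x_i^*(s)=\arg\min_{\hat{\mathbf x}_i\in\mathbb R^{n_i}}\Bigl\{\Phi_i(\hat{\mathbf x}_i)+\bigl(\mathbf A_i^T\boldsymbol\lambda_i(s)+\mathbf B_{ii}^T\boldsymbol\zeta_i(s)+\sum_{j\in\mathcal N_i}\mathbf B_{ij}^T\boldsymbol\zeta_j(s)\bigr)^T\hat{\mathbf x}_i\Bigr\},$$ $$\boldsymbol\lambda_i(s+1)=\Bigl[\boldsymbol\lambda_i(s)+\tfrac1{L_\Psi}\bigl(\mathbf A_i\mathbf x_i^*(s)-\mathbf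 a_i\bigr)\Bigr]_+,$$ $$\boldsymbol\zeta_i(s+1)=\Bigl[\boldsymbol\zeta_i(s)+\tfrac1{L_\Psi}\bigl(\mathbf B_{ii}\mathbf x_i^*(s)+\sum_{j\in\mathcal N_i}\mathbf B_{ji}\mathbf x_j^*(s)-\mathbf b_i\bigr)\Bigr]_+ .$$ Then $\boldsymbol\eta(s)$ converges, as $s\to\infty$, to one optimal solution $\boldsymbol\eta^{opt}$ of the dual problem $\max_{\hat{\boldsymbol\eta}\ge\mathbf 0}\Psi(\hat{\boldsymbol\eta})$, i.e. $\lim_{s\to\infty}\boldsymbol\eta(s)=\boldsymbol\eta^{opt}\in\arg\max_{\hat{\boldsymbol\eta}\ge\mathbf 0}\Psi(\hat{\boldsymbol\eta})$.
   Context: Notation. $\mathrm{col}\{\cdot\}$ stacks vectors into one column vector; vector inequalities are componentwise; $[\mathbf x]_+$ is the componentwise maximum of $\mathbf x$ and $0$. Network. $\mathcal G=(\mathcal V,\mathcal E)$ is a connected undirected graph with $\mathcal V=\{1,\dots,N\}$ ($(i,j)\in\mathcal E$ iff $(j,i)\in\mathcal E$); $\mathcal N_i=\{j:(i,j)\in\mathcal E\}$; $\mathcal V^G,\mathcal V^E\subset\mathcal V$ are the nodes with generators and with energy storage, respectively. $t_0$ is the current time and $K>1$ the integer horizon length; $t$ ranges over $t_0,\dots,t_0+K-1$. Decision variables (real): $P_i(t)$ for $i\in\mathcal V^G$; $E_i^c(t),E_i^d(t)$ for $i\in\mathcal V^E$; $F_{ij}(t)$ for $(i,j)\in\mathcal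 E$. By convention $P_i(t)=0$ for $i\notin\mathcal V^G$ and $E^c_i(t)=E^d_i(t)=0$ for $i\notin\mathcal V^E$. Constraints, for all $t$ in the horizon: (1) $0\le P_i(t)\le\tilde P_{i,t}$ and $\underline R_i\le P_i(t)-P_i(t-1)\le\overline R_i$ for $i\in\mathcal V^G$, with $P_i(t_0-1)$ given; (2) for $i\in\mathcal V^E$: $0\le E_i^c(t)\le\overline{E_i^c}$, $0\le E_i^d(t)\le\overline{E_i^d}$, and $0\le SoC_i(t+1)\le\overline{SoC_i}$, where $SoC_i(t+1)=(1-eff_i)SoC_i(t)+c_iE_i^c(t)-d_iE_i^d(t)$, with $SoC_i(t_0)$ given, $eff_i\in[0,1)$, $c_i>0$, $d_i>0$; (3) $0\le F_{ij}(t)\le\overline{F_{ij}}$ for $(i,j)\in\mathcal E$; (4) $P_i(t)-E_i^c(t)+E_i^d(t)+\sum_{j\in\mathcal N_i}[F_{ji}(t)-F_{ij}(t)]\ge\tilde D_{i,t}$ for $i\in\mathcal V$. All bounds are given real numbers; here $\tilde D_{i,t}=\mathrm{Expt}[D_i(t)]+\sqrt{(1-\epsilon)/\epsilon}\,\mathrm{Var}[D_i(t)]$ and $\tilde P_{i,t}=\mathrm{Expt}[\overline{P_i}(t)]-\sqrt{(1-\epsilon)/\epsilon}\,\mathrm{Var}[\overline{P_i}(t)]$ for given expectations and variances of the demand $D_i(t)$ and generation capacity $\overline{P_i}(t)$ and a given $\epsilon\in(0,1)$. Local vectors and costs. $\hat{\mathbf x}_i\in\mathbb R^{n_i}$ stacks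 all variables of agent $i$ over the horizon: $P_i(t)$ (if $i\in\mathcal V^G$), $E_i^c(t),E_i^d(t)$ (if $i\in\mathcal V^E$), $F_{ij}(t)$ for $j\in\mathcal N_i$; $\hat{\mathbf x}=\mathrm{col}\{\hat{\mathbf x}_i:i\in\mathcal V\}$. $\Phi_i(\hat{\mathbf x}_i)$ is the sum over $t$ of $\Phi_i^g(P_i(t))$ (if $i\in\mathcal V^G$), $\Phi_i^c(E_i^c(t))+\Phi_i^d(E_i^d(t))$ (if $i\in\mathcal V^E$) and $\sum_{j\in\mathcal N_i}\Phi_{ij}^f(F_{ij}(t))$. Matrices. $\mathbf A_i\hat{\mathbf x}_i\le\mathbf a_i$ ($\mathbf A_i\in\mathbb R^{m_i\times n_i}$) is the system of all local constraints (1), (2), (3) of agent $i$ written as linear inequalities in $\hat{\mathbf x}_i$ (with $SoC_i$ eliminated through its recursion). $\mathbf B_{ii},\mathbf B_{ij}\in\mathbb R^{K\times n_i}$ are defined by $\mathbf B_{ii}\hat{\mathbf x}_i=\mathrm{col}\{-P_i(t)+E_i^c(t)-E_i^d(t)+\sum_{j\in\mathcal N_i}F_{ij}(t):t\}$ and $\mathbf B_{ij}\hat{\mathbf x}_i=\mathrm{col}\{-F_{ij}(t):t\}$ for $j\in\mathcal N_i$, and $\mathbf b_i=\mathrm{col}\{-\tilde D_{i,t}:t\}$, so the second constraint of (MF) is (4). Dual objects. $\hat{\boldsymbol\lambda}_i\in\mathbb R^{m_i}$ and $\hat{\boldsymbol\zeta}_i\in\mathbb R^K$ are dual variables of the two constraint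 groups, $\hat{\boldsymbol\eta}=\mathrm{col}\{\hat{\boldsymbol\lambda}_i,\hat{\boldsymbol\zeta}_i:i\in\mathcal V\}$, and $$\mathcal L(\hat{\mathbf x},\hat{\boldsymbol\eta})=\sum_{i\in\mathcal V}\Bigl\{\Phi_i(\hat{\mathbf x}_i)+\hat{\boldsymbol\lambda}_i^T(\mathbf A_i\hat{\mathbf x}_i-\mathbf a_i)+\hat{\boldsymbol\zeta}_i^T\bigl(\mathbf B_{ii}\hat{\mathbf x}_i+\sum_{j\in\mathcal N_i}\mathbf B_{ji}\hat{\mathbf x}_j-\mathbf b_i\bigr)\Bigr\},$$ with the minimum defining $\Psi$ taken over all $\hat{\mathbf x}$ (unconstrained). Standing assumptions. (i) All the scalar functions $\Phi_i^g,\Phi_i^c,\Phi_i^d,\Phi_{ij}^f:\mathbb R\to\mathbb R$ are strongly convex and smooth (continuously differentiable with Lipschitz gradient) and increasing on $[0,\infty)$. (ii) There is a point satisfying all inequality constraints (1)–(4) strictly. *)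

(* Defs.v *)
From HB Require Import structures.
From mathcomp Require Import all_boot all_order all_algebra ring.
From mathcomp Require Import all_classical all_reals all_analysis.

Set Implicit Arguments.
Unset Strict Implicit.
Unset Printing Implicit Defensive.

Import Order.TTheory GRing.Theory Num.Theory.
Import numFieldNormedType.Exports.

Local Open Scope classical_set_scope.
Local Open Scope ring_scope.

Section Vectors.
Context {R : realType}.

Definition dotv n (u v : 'cV[R]_n) : R := (u^T *m v) 0 0.

(* The norm that MathComp-Analysis puts on matrices is the sup norm. *)
Definition norm2 n (v : 'cV[R]_n) : R := Num.sqrt (dotv v v).

Definition nonnegv n (v : 'cV[R]_n) : Prop := forall k, 0 <= v k 0.

Definition posv n (v : 'cV[R]_n) : 'cV[R]_n := map_mx (fun r => Num.max r 0) v.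

Definition grad n (f : 'cV[R]_n -> R) (v : 'cV[R]_n) : 'cV[R]_n :=
  \col_k 'D_(delta_mx k 0) f v.

Definition is_argmin (T : Type) (f : T -> R) (x : T) : Prop :=
  forall y, f x <= f y.

Definition matrix_of m n (f : 'cV[R]_n -> 'cV[R]_m) : 'M[R]_(m, n) :=
  \matrix_(r, s) f (delta_mx s 0) r 0.

Lemma matrix_ofE m n (f : 'cV[R]_n -> 'cV[R]_m) (x : 'cV[R]_n) :
  linear f -> matrix_of f *m x = f x.
Proof.
move=> lf.
pose g : {linear 'cV[R]_n -> 'cV[R]_m} := HB.pack f (GRing.isLinear.Build _ _ _ _ f lf).
have -> : f x = \sum_(s < n) x s 0 *: f (delta_mx s 0).
  rewrite -[f]/(g : _ -> _) {1}(matrix_sum_delta x) linear_sum.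
  apply: eq_bigr => s _; rewrite big_ord1 linearZ //.
apply/colP => r; rewrite !mxE summxE; apply: eq_bigr => s _.
by rewrite !mxE mulrC.
Qed.

End Vectors.

Section ScalarFunctions.
Context {R : realType}.

Definition strongly_convex (f : R -> R) : Prop :=
  exists2 mu : R, 0 < mu & forall x y t : R, 0 <= t <= 1 ->
    f (t * x + (1 - t) * y) <=
      t * f x + (1 - t) * f y - mu / 2 * (t * (1 - t)) * (x - y) ^+ 2.

Definition smooth (f : R -> R) : Prop :=
  [/\ forall x, derivable f x 1,
      continuous (derive1 f)
    & exists L : R, L.-lipschitz (derive1 f)].

Definition admissible_cost (f : R -> R) : Prop :=
  [/\ strongly_convex f, smooth f
    & {in `[0, +oo[ &, {homo f : x y / x < y}}].

End ScalarFunctions.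

Section Labels.
Variables N K : nat.

(* Labels of the decision variables of one agent, and of the quantities that
   its local constraints bound from below and from above.  The time argument
   [k : 'I_K] stands for the absolute time [t0 + k]; in [Flow j k] the label
   [j] is the receiving node. *)
Inductive slot :=
  Power of 'I_K | Charge of 'I_K | Discharge of 'I_K | Flow of 'I_N & 'I_K.

Inductive bounded :=
  PowerB of 'I_K | RampB of 'I_K | ChargeB of 'I_K | DischargeB of 'I_K
| SocB of 'I_K | FlowB of 'I_N & 'I_K.

Definition slot_code (s : slot) : ('I_K + 'I_K) + ('I_K + 'I_N * 'I_K) :=
  match s with
  | Power k => inl (inl k) | Charge k => inl (inr k)
  | Discharge k => inr (inl k) | Flow j k => inr (inr (j, k))
  end.

Definition slot_decode (c : ('I_K + 'I_K) + ('I_K + 'I_N * 'I_K)) : slot :=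
  match c with
  | inl (inl k) => Power k | inl (inr k) => Charge k
  | inr (inl k) => Discharge k | inr (inr (j, k)) => Flow j k
  end.

Lemma slot_codeK : cancel slot_code slot_decode.
Proof. by case. Qed.

HB.instance Definition _ := Equality.copy slot (can_type slot_codeK).
HB.instance Definition _ := Choice.copy slot (can_type slot_codeK).
HB.instance Definition _ := Countable.copy slot (can_type slot_codeK).
HB.instance Definition _ := Finite.copy slot (can_type slot_codeK).

Definition bounded_code (q : bounded) : (slot + ('I_K + 'I_K)) :=
  match q with
  | PowerB k => inl (Power k) | ChargeB k => inl (Charge k)
  | DischargeB k => inl (Discharge k) | FlowB j k => inl (Flow j k)
  | RampB k => inr (inl k) | SocB k => inr (inr k)
  end.

Definition bounded_decode (c : slot + ('I_K + 'I_K)) : bounded :=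
  match c with
  | inl (Power k) => PowerB k | inl (Charge k) => ChargeB k
  | inl (Discharge k) => DischargeB k | inl (Flow j k) => FlowB j k
  | inr (inl k) => RampB k | inr (inr k) => SocB k
  end.

Lemma bounded_codeK : cancel bounded_code bounded_decode.
Proof. by case. Qed.

HB.instance Definition _ := Equality.copy bounded (can_type bounded_codeK).
HB.instance Definition _ := Choice.copy bounded (can_type bounded_codeK).
HB.instance Definition _ := Countable.copy bounded (can_type bounded_codeK).
HB.instance Definition _ := Finite.copy bounded (can_type bounded_codeK).

End Labels.

Arguments Power {N K}. Arguments Charge {N K}.
Arguments Discharge {N K}. Arguments Flow {N K}.
Arguments PowerB {N K}. Arguments RampB {N K}. Arguments ChargeB {N K}.
Arguments DischargeB {N K}. Arguments SocB {N K}. Arguments FlowB {N K}.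

Record microgrid d (T : measurableType d) (R : realType) (P : probability T R)
    (N : nat) := Microgrid {
  edge : rel 'I_N;
  gens : {set 'I_N};
  stores : {set 'I_N};
  t0 : int;
  demand : 'I_N -> int -> {RV P >-> R};
  capacity : 'I_N -> int -> {RV P >-> R};
  risk : R;
  power_init : 'I_N -> R;
  ramp_min : 'I_N -> R;
  ramp_max : 'I_N -> R;
  charge_max : 'I_N -> R;
  discharge_max : 'I_N -> R;
  soc_max : 'I_N -> R;
  soc_init : 'I_N -> R;
  soc_loss : 'I_N -> R;
  charge_coef : 'I_N -> R;
  discharge_coef : 'I_N -> R;
  flow_max : 'I_N -> 'I_N -> R;
  cost_power : 'I_N -> R -> R;
  cost_charge : 'I_N -> R -> R;
  cost_discharge : 'I_N -> R -> R;
  cost_flow : 'I_N -> 'I_N -> R -> R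
}.

Section Microgrid.
Context d (T : measurableType d) (R : realType) (P : probability T R).
Context (N : nat) (K : nat) (M : microgrid P N).

Definition time (k : nat) : int := t0 M + k%:Z.

Record well_formed : Prop := WellFormed {
  edge_sym : symmetric (edge M);
  edge_irr : irreflexive (edge M);
  edge_connected : forall i j, connect (edge M) i j;
  risk_bounds : 0 < risk M < 1;
  demand_L2 : forall i (k : 'I_K),
    (demand M i (time k) : T -> R) \in Lfun P 2%:E;
  capacity_L2 : forall i (k : 'I_K), i \in gens M ->
    (capacity M i (time k) : T -> R) \in Lfun P 2%:E;
  soc_loss_bounds : forall i, i \in stores M -> 0 <= soc_loss M i < 1;
  charge_coef_gt0 : forall i, i \in stores M -> 0 < charge_coef M i;
  discharge_coef_gt0 : forall i, i \in stores M -> 0 < discharge_coef M i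
}.

Definition margin : R := Num.sqrt ((1 - risk M) / risk M).

(* The factor is the variance itself, not the standard deviation. *)
Definition robust_demand i (k : 'I_K) : R :=
  fine 'E_P[demand M i (time k)]%E + margin * fine 'V_P[demand M i (time k)]%E.

Definition robust_capacity i (k : 'I_K) : R :=
  fine 'E_P[capacity M i (time k)]%E - margin * fine 'V_P[capacity M i (time k)]%E.

Definition slots i : {set slot N K} := [set s | match s with
  | Power _ => i \in gens M
  | Charge _ | Discharge _ => i \in stores M
  | Flow j _ => edge M i j
  end].

Definition local_dim i : nat := #|slots i|.

(* The sum has at most one term; it is empty, giving the conventional value 0,
   when agent [i] has no variable labelled [s]. *)
Definition coord i (x : 'cV[R]_(local_dim i)) (s : slot N K) : R :=
  \sum_(r < local_dim i | enum_val r == s) x r 0.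

Definition power i (x : 'cV[R]_(local_dim i)) k := coord x (Power k).
Definition charge i (x : 'cV[R]_(local_dim i)) k := coord x (Charge k).
Definition discharge i (x : 'cV[R]_(local_dim i)) k := coord x (Discharge k).
Definition flow i (x : 'cV[R]_(local_dim i)) j k := coord x (Flow j k).

Definition at_nat (f : 'I_K -> R) (k : nat) : R :=
  if insub k is Some l then f l else 0.

(* [soc x k] is the state of charge at time [t0 + k], [k = 0, ..., K]. *)
Fixpoint soc i (x : 'cV[R]_(local_dim i)) (k : nat) : R :=
  if k is l.+1 then
    (1 - soc_loss M i) * soc x l + charge_coef M i * at_nat (charge x) l
      - discharge_coef M i * at_nat (discharge x) l
  else soc_init M i.

(* [prev_power x k] is the generation at time [t0 + k - 1]. *)
Definition prev_power i (x : 'cV[R]_(local_dim i)) (k : nat) : R :=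
  if k is l.+1 then at_nat (power x) l else power_init M i.

Definition bounds i : {set bounded N K} := [set q | match q with
  | PowerB _ | RampB _ => i \in gens M
  | ChargeB _ | DischargeB _ | SocB _ => i \in stores M
  | FlowB j _ => edge M i j
  end].

Definition quantity i (x : 'cV[R]_(local_dim i)) (q : bounded N K) : R :=
  match q with
  | PowerB k => power x k
  | RampB k => power x k - prev_power x k
  | ChargeB k => charge x k
  | DischargeB k => discharge x k
  | SocB k => soc x k.+1
  | FlowB j k => flow x j k
  end.

Definition lower i (q : bounded N K) : R :=
  if q is RampB _ then ramp_min M i else 0.

Definition upper i (q : bounded N K) : R :=
  match q with
  | PowerB k => robust_capacity i k
  | RampB _ => ramp_max M i
  | ChargeB _ => charge_max M i
  | DischargeB _ => discharge_max M i
  | SocB _ => soc_max M i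
  | FlowB j _ => flow_max M i j
  end.

(* One row per one-sided inequality; [true] marks an upper bound. *)
Definition rows i : {set bool * bounded N K} := [set r | r.2 \in bounds i].

Definition rows_dim i : nat := #|rows i|.

(* The local constraints of agent [i] read [residual x <= 0]. *)
Definition residual i (x : 'cV[R]_(local_dim i)) : 'cV[R]_(rows_dim i) :=
  \col_r let: (up, q) := enum_val r in
    if up then quantity x q - upper i q else lower i q - quantity x q.

Definition Amx i : 'M[R]_(rows_dim i, local_dim i) :=
  matrix_of (fun x => residual x - @residual i 0).

Definition avec i : 'cV[R]_(rows_dim i) := - @residual i 0.

Definition Bii i : 'M[R]_(K, local_dim i) :=
  matrix_of (fun x : 'cV[R]_(local_dim i) =>
    \col_k (- power x k + charge x k - discharge x k
            + \sum_(j | edge M i j) flow x j k)).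

(* [Bij i j] acts on the variables of agent [i]. *)
Definition Bij i (j : 'I_N) : 'M[R]_(K, local_dim i) :=
  matrix_of (fun x : 'cV[R]_(local_dim i) => \col_k - flow x j k).

Definition bvec i : 'cV[R]_K := \col_k - robust_demand i k.

Definition primal_dim : nat := \sum_i local_dim i.
Definition dual_dim : nat := \sum_i (rows_dim i + K).

Definition agent (x : 'cV[R]_primal_dim) i : 'cV[R]_(local_dim i) :=
  submxcol x i.
Definition lam (eta : 'cV[R]_dual_dim) i : 'cV[R]_(rows_dim i) :=
  usubmx (submxcol eta i).
Definition zeta (eta : 'cV[R]_dual_dim) i : 'cV[R]_K :=
  dsubmx (submxcol eta i).

Definition balance (x : 'cV[R]_primal_dim) i (k : 'I_K) : R :=
  power (agent x i) k - charge (agent x i) k + discharge (agent x i) k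
  + \sum_(j | edge M i j) (flow (agent x j) i k - flow (agent x i) j k).

Definition strictly_feasible (x : 'cV[R]_primal_dim) : Prop :=
  (forall i q, q \in bounds i -> lower i q < quantity (agent x i) q < upper i q)
  /\ (forall i k, robust_demand i k < balance x i k).

Definition coupling (x : forall i, 'cV[R]_(local_dim i)) i : 'cV[R]_K :=
  Bii i *m x i + \sum_(j | edge M i j) Bij j i *m x j.

Lemma coord_linear i (s : slot N K) :
  linear ((fun x => coord x s) : 'cV[R]_(local_dim i) -> R^o).
Proof.
move=> c x y; rewrite /coord scaler_sumr -big_split /=.
by apply: eq_bigr => r _; rewrite !mxE.
Qed.

Let coordl i c (x y : 'cV[R]_(local_dim i)) s :
  coord (c *: x + y) s = c * coord x s + coord y s.
Proof. exact: coord_linear. Qed.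

Let coord0 i s : coord (0 : 'cV[R]_(local_dim i)) s = 0.
Proof. by rewrite /coord big1// => r _; rewrite mxE. Qed.

Let at_natl i c (x y : 'cV[R]_(local_dim i)) (s : 'I_K -> slot N K) k :
  at_nat (fun l => coord (c *: x + y) (s l)) k =
  c * at_nat (fun l => coord x (s l)) k + at_nat (fun l => coord y (s l)) k.
Proof.
by rewrite /at_nat; case: insubP => [l _ _|_]; rewrite ?coordl ?mulr0 ?addr0.
Qed.

Let at_nat0 i (s : 'I_K -> slot N K) k :
  at_nat (fun l => coord (0 : 'cV[R]_(local_dim i)) (s l)) k = 0.
Proof. by rewrite /at_nat; case: insubP => [l _ _|//]; rewrite coord0. Qed.

Let socl i c (x y : 'cV[R]_(local_dim i)) k :
  soc (c *: x + y) k - soc (0 : 'cV[R]_(local_dim i)) k =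
  c * (soc x k - soc (0 : 'cV[R]_(local_dim i)) k)
  + (soc y k - soc (0 : 'cV[R]_(local_dim i)) k).
Proof.
elim: k => [|k IH] /=; first by rewrite !subrr mulr0 addr0.
rewrite /charge /discharge !at_natl !at_nat0.
move: IH; set s0 := soc _ k; set s1 := soc _ k; set s2 := soc _ k.
set s3 := soc _ k => IH.
have -> : s0 = c * (s2 - s1) + (s3 - s1) + s1 by rewrite -IH subrK.
ring.
Qed.

Lemma quantity_affine i c (x y : 'cV[R]_(local_dim i)) q :
  quantity (c *: x + y) q - quantity (0 : 'cV[R]_(local_dim i)) q =
  c * (quantity x q - quantity (0 : 'cV[R]_(local_dim i)) q)
  + (quantity y q - quantity (0 : 'cV[R]_(local_dim i)) q).
Proof.
case: q => [k|k|k|k|k|j k]; try exact: (socl c x y k.+1);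
  rewrite /= /power /charge /discharge /flow ?coordl ?coord0; try ring.
by case: k => -[|k] ltk; rewrite /prev_power /= /power ?at_natl ?at_nat0; ring.
Qed.

Lemma Amx_mulE i (x : 'cV[R]_(local_dim i)) : Amx i *m x - avec i = residual x.
Proof.
rewrite matrix_ofE ?opprK ?subrK// => c y z.
apply/colP => r; rewrite !mxE; case: (enum_val r) => -[] q.
- have := quantity_affine c y z q; set q0 := quantity (c *: _ + _) _ => H.
  by rewrite -[q0](subrK (quantity (0 : 'cV[R]_(local_dim i)) q)) H; ring.
- have := quantity_affine c y z q; set q0 := quantity (c *: _ + _) _ => H.
  by rewrite -[q0](subrK (quantity (0 : 'cV[R]_(local_dim i)) q)) H; ring.
Qed.

Lemma Amx_leP i (x : 'cV[R]_(local_dim i)) :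
  (forall r, (Amx i *m x) r 0 <= avec i r 0) <->
  (forall q, q \in bounds i -> lower i q <= quantity x q <= upper i q).
Proof.
have E r : ((Amx i *m x) r 0 <= avec i r 0) = (residual x r 0 <= 0).
  by rewrite -Amx_mulE -subr_le0 !mxE.
split=> [H q qi|H r]; last first.
  rewrite E mxE; case: (enum_val r) (enum_valP r) => up q.
  by rewrite inE /= => /H /andP[]; case: up => *; rewrite subr_le0.
apply/andP; split.
- have r : (false, q) \in rows i by rewrite inE.
  have := H (enum_rank_in r (false, q)).
  by rewrite E mxE enum_rankK_in// subr_le0.
- have r : (true, q) \in rows i by rewrite inE.
  have := H (enum_rank_in r (true, q)).
  by rewrite E mxE enum_rankK_in// subr_le0.
Qed.

Lemma Bii_mulE i (x : 'cV[R]_(local_dim i)) :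
  Bii i *m x = \col_k (- power x k + charge x k - discharge x k
                       + \sum_(j | edge M i j) flow x j k).
Proof.
rewrite matrix_ofE// => c y z; apply/colP => k; rewrite !mxE.
rewrite /power /charge /discharge !coordl.
under eq_bigr do rewrite /flow coordl.
rewrite big_split -mulr_sumr /=; rewrite /flow; ring.
Qed.

Lemma Bij_mulE i j (x : 'cV[R]_(local_dim i)) :
  Bij i j *m x = \col_k - flow x j k.
Proof.
rewrite matrix_ofE// => c y z; apply/colP => k; rewrite !mxE.
by rewrite /flow coordl; ring.
Qed.

Lemma coupling_leP (x : 'cV[R]_primal_dim) i :
  (forall k, coupling (agent x) i k 0 <= bvec i k 0) <->
  (forall k, robust_demand i k <= balance x i k).
Proof.
suff E k : coupling (agent x) i k 0 = - balance x i k.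
  have Eb k : bvec i k 0 = - robust_demand i k by rewrite mxE.
  by split=> H k; have := H k; rewrite E Eb lerN2.
rewrite /coupling Bii_mulE !mxE summxE.
under [X in _ + X]eq_bigr do rewrite Bij_mulE mxE.
by rewrite sumrN /balance sumrB; ring.
Qed.

Definition cost i (x : 'cV[R]_(local_dim i)) : R :=
  \sum_(k < K)
    ((if i \in gens M then cost_power M i (power x k) else 0)
     + (if i \in stores M then
          cost_charge M i (charge x k) + cost_discharge M i (discharge x k)
        else 0)
     + \sum_(j | edge M i j) cost_flow M i j (flow x j k)).

Definition admissible_costs : Prop :=
  [/\ forall i, i \in gens M -> admissible_cost (cost_power M i),
      forall i, i \in stores M -> admissible_cost (cost_charge M i),
      forall i, i \in stores M -> admissible_cost (cost_discharge M i)
    & forall i j, edge M i j -> admissible_cost (cost_flow M i j)].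

Definition lagrangian (x : 'cV[R]_primal_dim) (eta : 'cV[R]_dual_dim) : R :=
  \sum_i (cost (agent x i)
          + dotv (lam eta i) (Amx i *m agent x i - avec i)
          + dotv (zeta eta i) (coupling (agent x) i - bvec i)).

(* Under [admissible_costs] the infimum is a minimum. *)
Definition dual_function (eta : 'cV[R]_dual_dim) : R :=
  inf (range (lagrangian ^~ eta)).

Definition dual_optimal (eta : 'cV[R]_dual_dim) : Prop :=
  nonnegv eta /\
  forall eta', nonnegv eta' -> dual_function eta' <= dual_function eta.

Definition local_objective (eta : 'cV[R]_dual_dim) i
    (x : 'cV[R]_(local_dim i)) : R :=
  cost x + dotv ((Amx i)^T *m lam eta i + (Bii i)^T *m zeta eta i
                 + \sum_(j | edge M i j) (Bij i j)^T *m zeta eta j) x.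

End Microgrid.

Arguments dual_function {d T R P N} K M eta.

(* Main.v *)
(* The algorithm is projected gradient ascent with step 1/L on the concave dual
   function.  The cost is separable and strongly convex, so the Lagrangian has a
   unique minimizer, which depends on the multipliers in a Lipschitz way; hence
   the constraint residual at the minimizer, which is always a supergradient of
   the dual function, is its gradient.  The descent lemma and the variational
   inequality of the projection then give, for every y >= 0,
     Psi(y) - Psi(eta(s+1)) <= L/2 (|eta(s) - y|^2 - |eta(s+1) - y|^2).
   With y = eta(s) the dual values increase, and a Slater point then bounds the
   iterates; a general y shows that every cluster point is dual optimal; with y
   a cluster point the distance to it decreases, so the whole sequence
   converges. *)
Require Import Defs.
From HB Require Import structures.
From mathcomp Require Import all_boot all_order all_algebra ring lra.
From mathcomp Require Import all_classical all_reals all_analysis.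

Set Implicit Arguments.
Unset Strict Implicit.
Unset Printing Implicit Defensive.

Import Order.TTheory GRing.Theory Num.Theory.
Import numFieldNormedType.Exports.

Local Open Scope classical_set_scope.
Local Open Scope ring_scope.

(** * Euclidean inner product, Cauchy-Schwarz, and projection onto the nonnegative orthant *)

Section DotProduct.
Context {R : realType} {n : nat}.
Implicit Types (u v w : 'cV[R]_n) (a : R).

Lemma dotvE u v : dotv u v = \sum_k u k 0 * v k 0.
Proof. by rewrite /dotv mxE; apply: eq_bigr => k _; rewrite mxE. Qed.

Lemma dotvC u v : dotv u v = dotv v u.
Proof. by rewrite !dotvE; apply: eq_bigr => k _; rewrite mulrC. Qed.

Lemma dotvDr u v w : dotv u (v + w) = dotv u v + dotv u w.
Proof. by rewrite /dotv mulmxDr mxE. Qed.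

Lemma dotvZr a u v : dotv u (a *: v) = a * dotv u v.
Proof. by rewrite /dotv -scalemxAr mxE. Qed.

Lemma dotvNr u v : dotv u (- v) = - dotv u v.
Proof. by rewrite -scaleN1r dotvZr mulN1r. Qed.

Lemma dotvBr u v w : dotv u (v - w) = dotv u v - dotv u w.
Proof. by rewrite dotvDr dotvNr. Qed.

Lemma dotvDl u v w : dotv (u + v) w = dotv u w + dotv v w.
Proof. by rewrite dotvC dotvDr !(dotvC w). Qed.

Lemma dotvZl a u v : dotv (a *: u) v = a * dotv u v.
Proof. by rewrite dotvC dotvZr dotvC. Qed.

Lemma dotvNl u v : dotv (- u) v = - dotv u v.
Proof. by rewrite dotvC dotvNr dotvC. Qed.

Lemma dotvBl u v w : dotv (u - v) w = dotv u w - dotv v w.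
Proof. by rewrite dotvDl dotvNl. Qed.

Lemma dotv0r u : dotv u 0 = 0.
Proof. by rewrite /dotv mulmx0 mxE. Qed.

Lemma dotvv_ge0 v : 0 <= dotv v v.
Proof. by rewrite dotvE sumr_ge0// => k _; rewrite -expr2 sqr_ge0. Qed.

Lemma sqr_coord_le_dotvv v k : v k 0 ^+ 2 <= dotv v v.
Proof.
rewrite dotvE (bigD1 k)//= -expr2 lerDl sumr_ge0// => j _.
by rewrite -expr2 sqr_ge0.
Qed.

Lemma dotvv_eq0 v : dotv v v = 0 -> v = 0.
Proof.
move=> v0; apply/colP => k; rewrite mxE; apply/eqP; rewrite -sqrf_eq0.
by rewrite eq_le sqr_ge0 -v0 sqr_coord_le_dotvv.
Qed.

Lemma norm2_ge0 v : 0 <= norm2 v.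
Proof. exact: sqrtr_ge0. Qed.

Lemma norm2_sqr v : norm2 v ^+ 2 = dotv v v.
Proof. exact/sqr_sqrtr/dotvv_ge0. Qed.

Lemma norm2Z a v : norm2 (a *: v) = `|a| * norm2 v.
Proof.
by rewrite /norm2 dotvZl dotvZr mulrA -expr2 sqrtrM ?sqr_ge0// sqrtr_sqr.
Qed.

Lemma norm2B u v : norm2 (u - v) = norm2 (v - u).
Proof. by rewrite -opprB /norm2 dotvNl dotvNr opprK. Qed.

Lemma cauchy_schwarz_sqr u v : dotv u v ^+ 2 <= dotv u u * dotv v v.
Proof.
have [/dotvv_eq0 ->|v0] := eqVneq (dotv v v) 0.
  by rewrite !dotv0r expr0n mulr0.
have {v0} : 0 < dotv v v by rewrite lt_def v0 dotvv_ge0.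
move=> v0; rewrite -subr_ge0 -(pmulr_rge0 _ v0).
have := dotvv_ge0 (dotv v v *: u - dotv u v *: v).
rewrite !(dotvBl, dotvBr, dotvZl, dotvZr) (dotvC v u).
by congr (0 <= _); ring.
Qed.

Lemma cauchy_schwarz_norm u v : `|dotv u v| <= norm2 u * norm2 v.
Proof.
rewrite -(ler_pXn2r (ltn0Sn 1)) ?nnegrE ?mulr_ge0 ?norm2_ge0//.
by rewrite real_normK ?num_real// exprMn !norm2_sqr cauchy_schwarz_sqr.
Qed.

Lemma cauchy_schwarz u v : dotv u v <= norm2 u * norm2 v.
Proof. exact: le_trans (ler_norm _) (cauchy_schwarz_norm u v). Qed.

Lemma posv_ge0 v : nonnegv (posv v).
Proof. by move=> k; rewrite mxE le_max lexx orbT. Qed.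

(** In each coordinate either [v] and [posv v] agree, or [posv v] vanishes while [v] is nonpositive
    and [w] nonnegative. *)
Lemma posv_projection v w : nonnegv w -> dotv (v - posv v) (w - posv v) <= 0.
Proof.
move=> w0; rewrite dotvE sumr_le0// => k _; rewrite !mxE.
have := w0 k; case: (leP (v k 0) 0) => ?; nra.
Qed.

End DotProduct.

(** * Sup-norm balls versus Euclidean distance, and cluster points of bounded sequences *)

Section BolzanoWeierstrass.
Context {R : realType} {n : nat}.

Lemma ball_dotv (e : R) : 0 < e -> exists2 r : R, 0 < r &
  forall u v : 'cV[R]_n, ball u r v -> dotv (v - u) (v - u) < e.
Proof.
(* The squares of [n] coordinates, each below [q], sum to less than [e]; dividing by [n.+1] also
   covers dimension 0. *)
move=> e0; pose q := e / n.+1%:R.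
have q0 : 0 < q by rewrite divr_gt0.
exists (Num.sqrt q); first by rewrite sqrtr_gt0.
move=> u v [_ uv]; rewrite dotvE.
apply: (@le_lt_trans _ _ (\sum_(k < n) q)).
  apply: ler_sum => k _; rewrite -expr2 !mxE.
  have /= := uv k 0; rewrite /ball_ => h.
  rewrite -(sqr_sqrtr (ltW q0)) -real_normK ?num_real//.
  by rewrite lerXn2r ?nnegrE ?sqrtr_ge0// distrC ltW.
rewrite sumr_const card_ord -mulr_natr /q -mulrA gtr_pMr//.
by rewrite mulrC ltr_pdivrMr// mul1r ltr_nat.
Qed.

Lemma dotv_ball (e : R) (u v : 'cV[R]_n) : 0 < e ->
  dotv (v - u) (v - u) < e ^+ 2 -> ball u e v.
Proof.
move=> e0 h; split=> // k j; rewrite ord1 /ball /=.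
rewrite -(ltr_pXn2r (ltn0Sn 1)) ?nnegrE ?(ltW e0)//.
rewrite real_normK ?num_real//; apply: le_lt_trans h.
by have := sqr_coord_le_dotvv (v - u) k; rewrite !mxE -sqrrN opprB.
Qed.

Lemma bounded_sequence_cluster (v : nat -> 'cV[R]_n) (a b : 'I_n -> R) :
  (forall s k, a k <= v s k 0 <= b k) ->
  exists l : 'cV[R]_n, forall e, 0 < e -> forall s0,
    exists2 s, (s0 <= s)%N & dotv (v s - l) (v s - l) < e.
Proof.
move=> vab.
(* A box is compact as a product of segments; [rV_compact] concerns row vectors, hence the
   transposes. *)
have cK := @rV_compact _ n (fun k => `[a k, b k]%classic)
  (fun k => @segment_compact _ (a k) (b k)).
have [|l [_ ll]] := cK ((fun s => (v s)^T) @ \oo).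
  by exists 0%N => // s _ k /=; rewrite in_itv/= mxE; exact: vab.
exists l^T => e e0 s0.
have [r r0 rP] := ball_dotv e0.
have [||_ [[s s0s <-] lv]] :=
  ll ((fun s => (v s)^T) @` [set s | (s0 <= s)%N]) (ball l r).
- by exists s0 => // s s0s; exists s.
- exact: nbhsx_ballx.
exists s => //; case: lv => _ lv; apply: rP; split=> // k j.
by have := lv j k; rewrite !mxE ord1.
Qed.

End BolzanoWeierstrass.

(** * Projected gradient ascent for a function with a Lipschitz supergradient *)

Definition supergradient (R : realType) n (f : 'cV[R]_n -> R)
    (G : 'cV[R]_n -> 'cV[R]_n) : Prop :=
  forall u v, f v <= f u + dotv (G u) (v - u).

Definition lipschitz2 (R : realType) n m (C : R) (G : 'cV[R]_n -> 'cV[R]_m) : Prop :=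
  forall u v, norm2 (G u - G v) <= C * norm2 (u - v).

Lemma archi_gt (R : realType) (a b : R) : 0 < b -> exists n : nat, a < n.+1%:R * b.
Proof.
move=> b0; exists (Num.bound `|a / b|).
rewrite -ltr_pdivrMr//; apply: (@le_lt_trans _ _ `|a / b|); first exact: ler_norm.
by apply: (lt_trans (archi_boundP (normr_ge0 _))); rewrite ltr_nat.
Qed.

Section Ascent.
Context {R : realType} {n : nat}.
Variables (f : 'cV[R]_n -> R) (G : 'cV[R]_n -> 'cV[R]_n).
Hypothesis G_super : supergradient f G.

(** The supergradient inequalities at [u] and at [u + h e] squeeze the increment of [f] between [h]
    times the slopes [G (u + h e)] and [G u] along [e]; these differ by O(h). *)
Lemma grad_supergradient (C : R) : lipschitz2 C G -> grad f = G.
Proof.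
move=> GC; apply/funext => u; apply/colP => k; rewrite mxE.
set e := delta_mx k 0.
have -> : G u k 0 = dotv (G u) e.
  rewrite dotvE (bigD1 k)//= big1 ?mxE ?eqxx ?mulr1 ?addr0//.
  by move=> j jk; rewrite mxE (negPf jk) mulr0.
have C0 : 0 <= `|C| * norm2 e ^+ 2 by rewrite mulr_ge0 ?sqr_ge0.
have diff_quot h : h != 0 ->
    `|dotv (G u) e - h^-1 * (f (h *: e + u) - f u)| <= `|C| * norm2 e ^+ 2 * `|h|.
  move=> h0.
  have h1 := G_super u (h *: e + u).
  have h2 := G_super (h *: e + u) u.
  rewrite addrK dotvZr in h1.
  rewrite opprD addrCA subrr addr0 dotvNr dotvZr in h2.
  have h3 : `|dotv (G (h *: e + u) - G u) e| <= `|C| * norm2 e ^+ 2 * `|h|.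
    apply: (le_trans (cauchy_schwarz_norm _ _)).
    rewrite expr2 mulrA mulrAC; apply: (ler_wpM2r (norm2_ge0 _)).
    apply: (le_trans (GC _ _)); rewrite addrK norm2Z mulrA mulrAC.
    by do 2![apply: ler_wpM2r; rewrite ?norm2_ge0 ?normr_ge0//]; exact: ler_norm.
  rewrite dotvBl in h3.
  have -> : dotv (G u) e - h^-1 * (f (h *: e + u) - f u) =
      h^-1 * (h * dotv (G u) e - (f (h *: e + u) - f u)).
    by rewrite [RHS]mulrBr mulKf.
  rewrite normrM normfV ler_pdivrMl ?normr_gt0//.
  apply: le_trans (ler_wpM2l (normr_ge0 h) h3).
  rewrite -normrM ger0_norm; last lra.
  by rewrite -normrN; apply: le_trans (ler_norm _); lra.
apply/cvg_lim; first exact: Rhausdorff.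
apply/cvgrPdist_le => eps eps0.
near=> h.
have h0 : h != 0 by near: h; exact: nbhs_dnbhs_neq.
apply: (le_trans (diff_quot h h0)).
(* The added 1 keeps the denominator positive when [C] is 0. *)
have hd : `|h| <= eps / (`|C| * norm2 e ^+ 2 + 1).
  by near: h; apply: dnbhs0_le; rewrite divr_gt0// ltr_wpDl.
rewrite ler_pdivlMr in hd; last by rewrite ltr_wpDl.
by apply: le_trans hd; rewrite mulrC ler_wpM2l// lerDl.
Unshelve. all: by end_near. Qed.

Variable L : R.
Hypothesis L_gt0 : 0 < L.
Hypothesis G_lip : lipschitz2 L G.

(* Applying the supergradient inequality to each of [k] equal steps gives the
   descent lemma, in the limit of small [h], without integrating the gradient. *)
Lemma ascent_partition (u v : 'cV[R]_n) (h : R) k : 0 <= h ->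
  f u + h * k%:R * dotv (G u) v
    - L * dotv v v * h ^+ 2 * (k%:R * (k%:R + 1)) / 2 <= f (u + (h * k%:R) *: v).
Proof.
move=> h0; elim: k => [|k IH].
  by rewrite !mulr0 scale0r addr0 !mul0r mulr0 mul0r subr0 addr0.
set w := u + (h * k.+1%:R) *: v.
(* The inequality is taken at the far end [w] of the step, where the slope along [v] has dropped by
   at most [L h (k+1) |v|^2]; these losses add up to the triangular number in the statement. *)
have h1 := G_super w (u + (h * k%:R) *: v).
have vE : u + (h * k%:R) *: v - w = - (h *: v).
  rewrite /w opprD addrACA subrr add0r -scalerBl -[RHS]scaleNr; congr (_ *: _).
  by rewrite -natr1; ring.
rewrite vE dotvNr dotvZr in h1.
have h2 : dotv (G u) v - dotv (G w) v <= L * (h * k.+1%:R) * dotv v v.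
  rewrite -dotvBl; apply: (le_trans (cauchy_schwarz _ _)).
  rewrite -norm2_sqr expr2 mulrA; apply: (ler_wpM2r (norm2_ge0 _)).
  apply: (le_trans (G_lip _ _)); rewrite norm2B addrC addKr norm2Z.
  by rewrite ger0_norm ?mulrA ?mulr_ge0.
have h3 := ler_wpM2l h0 h2.
move: h1 h3 IH; move: (f w) (f (u + _)) (dotv (G w) v) => fw fv Gw.
rewrite -natr1 expr2; nra.
Qed.

Lemma descent_lemma (u v : 'cV[R]_n) :
  f u + dotv (G u) v - L / 2 * dotv v v <= f (u + v).
Proof.
apply/ler_addgt0Pr => e e0.
have c0 : 0 <= L * dotv v v / 2 by rewrite !mulr_ge0 ?invr_ge0 ?dotvv_ge0 ?ltW.
(* With [m.+1] steps of length [h = 1/(m+1)] the error exceeds [L/2 |v|^2] by [h] times that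
   quantity, which this [m] makes at most [e]. *)
have [m] := archi_gt (L * dotv v v / 2) e0.
set h : R := m.+1%:R^-1 => hm.
have m0 : m.+1%:R != 0 :> R by rewrite pnatr_eq0.
have := @ascent_partition u v h m.+1 _.
rewrite mulVf// !mul1r scale1r => /(_ _) H.
have {H} := H ltac:(by rewrite invr_ge0).
have -> : L * dotv v v * h ^+ 2 * (m.+1%:R * (m.+1%:R + 1)) / 2 =
   L * dotv v v / 2 + h * (L * dotv v v / 2).
  by rewrite /h; field.
have : h * (L * dotv v v / 2) <= e by rewrite mulrC ler_pdivrMr ?ltr0n// [leRHS]mulrC ltW.
lra.
Qed.

Definition ascent_step (u : 'cV[R]_n) : 'cV[R]_n := posv (u + L^-1 *: G u).

Lemma ascent_step_le (u y : 'cV[R]_n) : nonnegv y ->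
  f y - f (ascent_step u) <=
  L / 2 * (dotv (u - y) (u - y) - dotv (ascent_step u - y) (ascent_step u - y)).
Proof.
move=> y0; have h1 := G_super u y.
have := descent_lemma u (ascent_step u - u); rewrite subrKC => h2.
have := posv_projection (u + L^-1 *: G u) y0; rewrite -/(ascent_step u).
move: (ascent_step u) h2 => p h2 h3.
(* Combined with [h1] and [h2], this leaves [L (p-u).(y-p) + L/2 |p-u|^2], which equals
   [L/2 (|u-y|^2 - |p-y|^2)]. *)
have {}h3 : dotv (G u) (y - p) <= L * dotv (p - u) (y - p).
  move: h3; rewrite -(pmulr_rle0 _ L_gt0) !dotvBl dotvDl dotvZl.
  by rewrite mulrBr mulrDr mulVKf ?gt_eqF//; lra.
move: h1 h2 h3; rewrite !(dotvBl, dotvBr) (dotvC p u) (dotvC y p) (dotvC y u); nra.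
Qed.

Variables (c : R) (w : 'cV[R]_n).
Hypothesis w_lt0 : forall k, w k 0 < 0.
Hypothesis f_le : forall u, f u <= c + dotv u w.

(** For a dual function, [w] is the constraint residual at a Slater point and [c] the cost there, so
    [f_le] is weak duality. *)
Theorem ascent_cvg (u : nat -> 'cV[R]_n) :
  (forall s, u s.+1 = ascent_step (u s)) ->
  exists2 l, (nonnegv l /\ forall v, nonnegv v -> f v <= f l) & u s @[s --> \oo] --> l.
Proof.
move=> uS.
(* The initial point may have negative coordinates, so every estimate starts at index 1. *)
have u_ge0 s : nonnegv (u s.+1) by rewrite uS; exact: posv_ge0.
have step s y : nonnegv y -> f y - f (u s.+1) <=
    L / 2 * (dotv (u s - y) (u s - y) - dotv (u s.+1 - y) (u s.+1 - y)).
  by move=> y0; rewrite uS; exact: ascent_step_le.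
have L2 : 0 < L / 2 by rewrite divr_gt0.
have fS s : f (u s.+1) <= f (u s.+2).
  have := step s.+1 (u s.+1) (u_ge0 s); rewrite subrr dotv0r sub0r mulrN.
  have : 0 <= L / 2 * dotv (u s.+2 - u s.+1) (u s.+2 - u s.+1).
    by rewrite mulr_ge0 ?dotvv_ge0 ?ltW.
  lra.
have f_mono s t : (s <= t)%N -> f (u s.+1) <= f (u t.+1).
  exact: (@homo_leq _ (fun s => f (u s.+1)) <=%O (@lexx _ _) (@le_trans _ _)).
(* All terms of [dotv (u s.+1) w] are nonpositive, so each one alone is bounded below through [f_le]
   by [f (u 1) - c]. *)
have bnd s k : 0 <= u s.+1 k 0 <= (c - f (u 1%N)) / - w k 0.
  rewrite u_ge0/= ler_pdivlMr ?oppr_gt0//.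
  have := le_trans (f_mono 0%N s (leq0n s)) (f_le (u s.+1)).
  have : dotv (u s.+1) w <= u s.+1 k 0 * w k 0.
    rewrite dotvE (bigD1 k)//= gerDl sumr_le0// => j _.
    by apply: mulr_ge0_le0; [exact: u_ge0 | exact: ltW].
  lra.
have [l lP] := bounded_sequence_cluster bnd.
have l_ge0 : nonnegv l.
  move=> k; rewrite leNgt; apply/negP => lk.
  (* A negative coordinate of [l] would keep every nonnegative iterate at squared distance at least
     its square. *)
  have lk2 : 0 < l k 0 ^+ 2 by nra.
  have [s _] := lP _ lk2 0%N.
  have := sqr_coord_le_dotvv (u s.+1 - l) k; rewrite !mxE.
  have := u_ge0 s k; nra.
have f_lel s : f (u s.+1) <= f l.
  apply/ler_addgt0Pr => e e0.
  (* By the supergradient at [l], an iterate within [q] of [l] has value at most [f l + e];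
     monotonicity carries this back to earlier iterates. *)
  pose q := e / (norm2 (G l) + 1).
  have G1 : 0 < norm2 (G l) + 1 by rewrite ltr_wpDl ?norm2_ge0.
  have q0 : 0 < q by rewrite divr_gt0.
  have [t st tP] := lP (q ^+ 2) ltac:(by rewrite exprn_gt0) s.
  apply: (le_trans (f_mono _ _ st)); apply: (le_trans (G_super l _)).
  rewrite lerD2l; apply: (le_trans (cauchy_schwarz _ _)).
  have : norm2 (u t.+1 - l) <= q.
    rewrite -(ler_pXn2r (ltn0Sn 1)) ?nnegrE ?norm2_ge0 ?(ltW q0)//.
    by rewrite norm2_sqr ltW.
  have -> : e = (norm2 (G l) + 1) * q by rewrite /q mulrCA mulfV ?gt_eqF ?mulr1.
  by have := norm2_ge0 (G l); nra.
have l_opt v : nonnegv v -> f v <= f l.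
  move=> v0; rewrite leNgt; apply/negP => flv.
  pose e := f v - f l.
  have e0 : 0 < e by rewrite subr_gt0.
  (* If [v] beat [l] by [e], each step would lower the squared distance to [v] by at least
     [2 e / L], which cannot go on forever. *)
  have dec s : s%:R * e <= L / 2 * (dotv (u 1%N - v) (u 1%N - v) -
      dotv (u s.+1 - v) (u s.+1 - v)).
    elim: s => [|s IH]; first by rewrite mul0r subrr mulr0.
    have := step s.+1 v v0; have := f_lel s.+1.
    by move: IH; rewrite -natr1 /e; nra.
  have [m] := archi_gt (L / 2 * dotv (u 1%N - v) (u 1%N - v)) e0.
  apply/negP; rewrite -leNgt; apply: (le_trans (dec m.+1)).
  by apply: (ler_wpM2l (ltW L2)); rewrite gerBl dotvv_ge0.
exists l => //.
have dist_mono s t : (s <= t)%N ->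
    dotv (u t.+1 - l) (u t.+1 - l) <= dotv (u s.+1 - l) (u s.+1 - l).
  apply: (@homo_leq _ (fun s => dotv (u s.+1 - l) (u s.+1 - l))
    (fun a b => b <= a) (fun=> lexx _) (fun b a d ba db => le_trans db ba)).
  move=> r /=; rewrite -subr_ge0 -(pmulr_rge0 _ L2).
  by apply: le_trans (step r.+1 l l_ge0); rewrite subr_ge0 f_lel.
apply/cvg_ballP => e e0.
(* One iterate near the cluster point suffices, since the distance to it never grows afterwards. *)
have [s _ sP] := lP (e ^+ 2) ltac:(by rewrite exprn_gt0) 0%N.
exists s.+1 => // -[//|t] /= st.
by apply: dotv_ball => //; apply: le_lt_trans sP; exact: dist_mono.
Qed.

End Ascent.

Lemma dotv_tr (R : realType) m n (A : 'M[R]_(m, n)) u v :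
  dotv (A^T *m u) v = dotv u (A *m v).
Proof. by rewrite /dotv trmx_mul trmxK mulmxA. Qed.

Lemma mulmx_bounded (R : realType) m n (A : 'M[R]_(m, n)) : exists2 C : R, 0 <= C &
  forall v : 'cV[R]_n, dotv (A *m v) (A *m v) <= C * dotv v v.
Proof.
(* The squared Frobenius norm; Cauchy-Schwarz is applied row by row. *)
exists (\sum_r dotv (row r A)^T (row r A)^T) => [|v].
  by rewrite sumr_ge0// => r _; exact: dotvv_ge0.
rewrite dotvE mulr_suml ler_sum// => r _.
have -> : (A *m v) r 0 = dotv (row r A)^T v by rewrite /dotv trmxK -row_mul [RHS]mxE.
by rewrite -expr2 cauchy_schwarz_sqr.
Qed.

(** * Strong convexity, growth away from a minimizer, and existence of minimizers *)

Definition midpoint_convex (R : realType) n (mu : R) (f : 'cV[R]_n -> R) : Prop :=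
  forall x y, f (2^-1 *: (x + y)) <= (f x + f y) / 2 - mu * dotv (x - y) (x - y).

(** The minimal value is compared with the value at the midpoint of [x] and [y]. *)
Lemma midpoint_growth (R : realType) n (mu : R) (f : 'cV[R]_n -> R) x y :
  midpoint_convex mu f -> is_argmin f x ->
  f x + 2 * mu * dotv (x - y) (x - y) <= f y.
Proof. by move=> /(_ x y) h /(_ (2^-1 *: (x + y))); lra. Qed.

Section ScalarMin.
Context {R : realType}.

Lemma strongly_convex_affine (f : R -> R) (c : R) :
  strongly_convex f -> strongly_convex (fun y => f y + c * y).
Proof.
move=> [mu mu0 fmu]; exists mu => // x y t t01.
by have := fmu x y t t01; lra.
Qed.

Lemma strongly_convex_argmin (f : R -> R) : strongly_convex f -> continuous f ->
  exists x, is_argmin f x.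
Proof.
move=> [mu mu0 fmu] fc.
(* For [y > B], write 1 or -1 as a convex combination of [e * y] and 0 with weight [1/y]; the
   convexity gain [mu/2 (y-1)] then exceeds [|f e - f 0|], forcing [f (e * y)] above [f 0]. *)
pose B := 1 + 2 * (`|f 1 - f 0| + `|f (-1) - f 0|) / mu.
have p0 : 0 <= 2 * (`|f 1 - f 0| + `|f (-1) - f 0|) / mu.
  by rewrite !mulr_ge0 ?invr_ge0 ?addr_ge0 ?normr_ge0 ?(ltW mu0).
have far (e y : R) : e = 1 \/ e = - 1 -> B < y -> f 0 <= f (e * y).
  move=> e1 By.
  have y0 : 0 < y by rewrite /B in By; lra.
  have y1 : 1 <= y by rewrite /B in By; lra.
  have := fmu (e * y) 0 y^-1; rewrite invr_ge0 (ltW y0) invf_le1// y1 => /(_ isT).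
  rewrite mulr0 addr0 subr0 mulrCA mulVf ?gt_eqF// mulr1.
  have -> : (e * y) ^+ 2 = y ^+ 2 by case: e1 => ->; ring.
  have -> : mu / 2 * (y^-1 * (1 - y^-1)) * y ^+ 2 = mu / 2 * (y - 1).
    by field; rewrite gt_eqF.
  have : `|f e - f 0| <= mu / 2 * (y - 1).
    have : mu * (B - 1) = 2 * (`|f 1 - f 0| + `|f (-1) - f 0|).
      by rewrite /B; field; rewrite gt_eqF.
    have := normr_ge0 (f 1 - f 0); have := normr_ge0 (f (-1) - f 0).
    by case: e1 => ->; nra.
  rewrite ler_norml => /andP[h _] h2.
  have h3 : y^-1 * (f 0 - f (e * y)) <= 0 by lra.
  by move: h3; rewrite pmulr_rle0 ?invr_gt0// subr_le0.
have B0 : - B <= B by rewrite /B; lra.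
have [x xB xmin] := EVT_min B0 (continuous_subspaceT fc).
exists x => y.
have [yB|] := boolP (y \in `[- B, B]); first exact: xmin.
have x0 : f x <= f 0 by apply: xmin; rewrite in_itv/= /B; apply/andP; split; lra.
rewrite in_itv/= negb_and -!ltNge => yB; apply: (le_trans x0).
case/orP: yB => yB.
  by have := far (-1) (- y) (or_intror erefl) _; rewrite mulN1r opprK; apply; lra.
by have := far 1 y (or_introl erefl) yB; rewrite mul1r.
Qed.

Lemma finite_lower_bound (I : finType) (Q : I -> R -> Prop) :
  (forall i, exists2 mu, 0 < mu & Q i mu) ->
  (forall i mu nu, nu <= mu -> Q i mu -> Q i nu) ->
  exists2 mu, 0 < mu & forall i, Q i mu.
Proof.
move=> Qex Qmono.
have /choice[mu muP] : forall i, exists mu, 0 < mu /\ Q i mu.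
  by move=> i; have [mu ? ?] := Qex i; exists mu.
(* The default value 1 keeps the minimum positive when [I] is empty. *)
exists (\big[Num.min/1]_i mu i).
  by apply: lt_bigmin => // i _; have [] := muP i.
by move=> i; apply: Qmono (muP i).2; exact: bigmin_le.
Qed.

Lemma midpoint_convex_sum n (f : 'I_n -> R -> R) :
  (forall r, strongly_convex (f r)) -> exists2 mu, 0 < mu &
  midpoint_convex mu (fun x : 'cV[R]_n => \sum_r f r (x r 0)).
Proof.
move=> fsc.
pose Q r mu := forall a b : R,
  f r (2^-1 * (a + b)) <= (f r a + f r b) / 2 - mu * (a - b) ^+ 2.
have [||mu mu0 muP] := @finite_lower_bound _ Q.
(* At weight 1/2 the term [mu/2 * t(1-t)] is [mu/8]. *)
- move=> r; have [mu mu0 h] := fsc r; exists (mu / 8); first by rewrite divr_gt0.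
  move=> a b; have := h a b 2^-1 _.
  have -> : 2^-1 * a + (1 - 2^-1) * b = 2^-1 * (a + b) :> R by field.
  move=> H; have {}H := H ltac:(by apply/andP; split; lra).
  by apply: le_trans H _; lra.
- by move=> r mu nu numu h a b; apply: (le_trans (h a b)); have := sqr_ge0 (a - b); nra.
exists mu => // x y; rewrite dotvE mulr_sumr -big_split mulr_suml -sumrB/=.
by apply: ler_sum => r _; rewrite !mxE -expr2; exact: muP.
Qed.

End ScalarMin.

(** * Lagrangian duality for a strongly convex cost under affine inequality constraints *)

Section Duality.
Context {R : realType} {p m : nat}.
Variables (Phi : 'cV[R]_p -> R) (A : 'M[R]_(m, p)) (a : 'cV[R]_m).

Let lag (x : 'cV[R]_p) (u : 'cV[R]_m) : R := Phi x + dotv u (A *m x - a).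

Definition dual (u : 'cV[R]_m) : R := inf (range (lag ^~ u)).

Lemma dual_argmin x u : is_argmin (lag ^~ u) x -> dual u = lag x u.
Proof.
move=> xmin; apply/eqP; rewrite eq_le; apply/andP; split.
  by apply: ge_inf; [exists (lag x u) => _ [y _ <-]; exact: xmin|exists x].
by apply: lb_le_inf; [exists (lag x u), x|move=> _ [y _ <-]; exact: xmin].
Qed.

Lemma dual_le x y u : is_argmin (lag ^~ u) y -> dual u <= lag x u.
Proof. by move=> ymin; rewrite (dual_argmin ymin); exact: ymin. Qed.

Variable mu : R.
Hypotheses (mu_gt0 : 0 < mu) (Phi_convex : midpoint_convex mu Phi).
Hypothesis argmin_ex : forall u, exists x, is_argmin (lag ^~ u) x.

Let xmin u : 'cV[R]_p := sval (cid (argmin_ex u)).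
Let xminP u : is_argmin (lag ^~ u) (xmin u).
Proof. by rewrite /xmin; case: cid. Qed.

Let G u := A *m xmin u - a.

Lemma lag_convex u : midpoint_convex mu (lag ^~ u).
Proof.
move=> x y; rewrite /lag; have := Phi_convex x y.
move: (dotv (x - y) (x - y)) => D.
by rewrite -scalemxAr mulmxDr !dotvBr !(dotvZr, dotvDr); lra.
Qed.

(** Add the growth inequality of each minimizer tested at the other one: the costs cancel. *)
Lemma argmin_monotone x y u v : is_argmin (lag ^~ u) x -> is_argmin (lag ^~ v) y ->
  4 * mu * dotv (x - y) (x - y) <= dotv (u - v) (A *m (y - x)).
Proof.
move=> xu yv.
have := midpoint_growth y (lag_convex u) xu.
have := midpoint_growth x (lag_convex v) yv.
rewrite -(opprB x y) dotvNl dotvNr opprK mulmxN mulmxBr.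
by rewrite /lag !(dotvBl, dotvBr, dotvNr); lra.
Qed.

Lemma argmin_unique x u : is_argmin (lag ^~ u) x -> x = xmin u.
Proof.
move=> xu; apply/subr0_eq/dotvv_eq0/eqP; rewrite eq_le dotvv_ge0 andbT.
have := argmin_monotone xu (xminP u); rewrite subrr (dotvC 0) dotv0r.
by rewrite pmulr_rle0// mulr_gt0.
Qed.

(** The minimizer for [u] is a trial point for [v], and the Lagrangian is affine in the
    multiplier. *)
Lemma dual_supergradient : supergradient dual G.
Proof.
move=> u v; rewrite (dual_argmin (xminP u)).
apply: (le_trans (dual_le (xmin u) (xminP v))).
by rewrite /lag /G dotvBr (dotvC _ v) (dotvC _ u); lra.
Qed.

Lemma dual_gradient_lipschitz : exists C, lipschitz2 C G.
Proof.
have [C C0 AC] := mulmx_bounded A.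
exists (C / (4 * mu)) => u v.
have -> : G u - G v = - (A *m (xmin v - xmin u)).
  by rewrite /G opprB addrA subrK mulmxBr opprB.
set w := A *m _.
have mu4 : 0 < 4 * mu by rewrite mulr_gt0.
(* Bound [|w|^2] by [C] times the squared distance of the minimizers, apply [argmin_monotone] and
   Cauchy-Schwarz, then cancel one factor [|w|]. *)
have h : norm2 w ^+ 2 <= C / (4 * mu) * (norm2 (u - v) * norm2 w).
  rewrite norm2_sqr; apply: (le_trans (AC _)).
  rewrite -mulrA; apply: ler_wpM2l => //; rewrite ler_pdivlMl//.
  apply: le_trans (cauchy_schwarz _ _).
  apply: le_trans (argmin_monotone (xminP u) (xminP v)).
  by rewrite -(opprB (xmin u)) dotvNl dotvNr opprK.
rewrite -scaleN1r norm2Z normrN1 mul1r.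
have [->|w0] := eqVneq (norm2 w) 0.
  by rewrite mulr_ge0 ?norm2_ge0// divr_ge0// ltW.
have wp : 0 < norm2 w by rewrite lt_def w0 norm2_ge0.
rewrite -(ler_pM2r wp) -expr2 -[leRHS]mulrA.
exact: h.
Qed.

Theorem dual_ascent_cvg (x0 : 'cV[R]_p) (L : R)
    (u : nat -> 'cV[R]_m) (x : nat -> 'cV[R]_p) :
  (forall k, (A *m x0 - a) k 0 < 0) -> 0 < L -> lipschitz2 L (grad dual) ->
  (forall s, is_argmin (lag ^~ (u s)) (x s)) ->
  (forall s, u s.+1 = posv (u s + L^-1 *: (A *m x s - a))) ->
  exists2 l, (nonnegv l /\ forall v, nonnegv v -> dual v <= dual l)
    & u s @[s --> \oo] --> l.
Proof.
move=> slater L0 lipL xs uS; have [C GC] := dual_gradient_lipschitz.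
(* The constant [C] serves only to identify the gradient with [G]; the step length comes from
   [L]. *)
rewrite (grad_supergradient dual_supergradient GC) in lipL.
apply: (ascent_cvg dual_supergradient L0 lipL slater (c := Phi x0)).
  by move=> v; exact: dual_le (xminP v).
by move=> s; rewrite uS (argmin_unique (xs s)).
Qed.

End Duality.

(** * Block vectors, and the microgrid problem in stacked form *)

Lemma dotv_mxcol (R : realType) N (q : 'I_N -> nat)
    (u : 'cV[R]_(\sum_i q i)) (v : forall i, 'cV[R]_(q i)) :
  dotv u (\mxcol_i v i) = \sum_i dotv (submxcol u i) (v i).
Proof.
by rewrite -{1}(submxcolK u) /dotv tr_mxcol mul_mxrow_mxcol summxE.
Qed.

Lemma dotv_col_mx (R : realType) m n (u : 'cV[R]_(m + n)) v w :
  dotv u (col_mx v w) = dotv (usubmx u) v + dotv (dsubmx u) w.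
Proof. by rewrite -{1}(vsubmxK u) /dotv tr_col_mx mul_row_col mxE. Qed.

Lemma submxcol_posv_step (R : realType) N (q : 'I_N -> nat)
    (u : 'cV[R]_(\sum_i q i)) (c : R) (v : forall i, 'cV[R]_(q i)) i :
  submxcol (posv (u + c *: \mxcol_j v j)) i = posv (submxcol u i + c *: v i).
Proof. by rewrite -[in RHS](mxcolK v i); apply/colP => r; rewrite !mxE. Qed.

Section MicrogridDual.
Context d (T : measurableType d) (R : realType) (P : probability T R).
Context (N K : nat) (M : microgrid P N).

Notation primal := 'cV[R]_(primal_dim K M).
Notation dualv := 'cV[R]_(dual_dim K M).
Notation local i := 'cV[R]_(local_dim K M i).

Definition slot_cost i (s : slot N K) : R -> R :=
  match s with
  | Power _ => cost_power M i
  | Defs.Charge _ => cost_charge M i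
  | Discharge _ => cost_discharge M i
  | Flow j _ => cost_flow M i j
  end.

Lemma coord_enum_val i (x : local i) (r : 'I_(local_dim K M i)) :
  Defs.coord x (enum_val r) = x r 0.
Proof.
by rewrite /Defs.coord (big_pred1 r)// => j; exact: (inj_eq enum_val_inj).
Qed.

Lemma sum_slot (F : slot N K -> R) : \sum_s F s =
  \sum_k (F (Power k) + (F (Defs.Charge k) + F (Discharge k)) + \sum_j F (Flow j k)).
Proof.
rewrite (reindex (@slot_decode N K)) /=; last first.
  by exists (@slot_code N K) => [[[]|[|[]]]|[]].
rewrite !big_sumType /= !big_split /= -!addrA; do 3!congr (_ + _).
by rewrite exchange_big pair_big; apply: eq_bigr => -[].
Qed.

(** The guards in [cost] are exactly membership in [slots i], so each coordinate carries one scalar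
    cost. *)
Lemma cost_separable i (x : local i) :
  cost x = \sum_r slot_cost i (enum_val r) (x r 0).
Proof.
under eq_bigr do rewrite -coord_enum_val.
rewrite -(big_enum_val (fun s => slot_cost i s (Defs.coord x s))) big_mkcond sum_slot.
apply: eq_bigr => k _; rewrite !inE; congr (_ + _ + _).
  by case: ifP; rewrite ?addr0.
by rewrite big_mkcond; apply: eq_bigr => j _; rewrite inE.
Qed.

Hypothesis costs : admissible_costs M.

Lemma slot_cost_admissible i (r : 'I_(local_dim K M i)) :
  admissible_cost (slot_cost i (enum_val r)).
Proof.
have [cp cc cd cf] := costs.
by case: (enum_val r) (enum_valP r) => [k|k|k|j k]; rewrite inE;
  [exact: cp|exact: cc|exact: cd|exact: cf].
Qed.

Lemma local_objective_argmin (eta : dualv) i :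
  exists x, is_argmin (local_objective eta (i := i)) x.
Proof.
rewrite /local_objective; move: (_ + _ + _) => b.
(* The objective splits over coordinates, each a strongly convex scalar function plus a linear
   term. *)
have /choice[x xP] : forall r, exists y : R,
    is_argmin (fun y => slot_cost i (enum_val r) y + b r 0 * y) y.
  move=> r; have [sc [df _ _] _] := slot_cost_admissible r.
  apply: strongly_convex_argmin; first exact: strongly_convex_affine.
  move=> y; apply: cvgD; last exact: mulrl_continuous.
  exact/differentiable_continuous/derivable1_diffP/df.
exists (\col_r x r) => y; rewrite !cost_separable !dotvE -!big_split /=.
by apply: ler_sum => r _; rewrite mxE; exact: xP.
Qed.

Definition total_cost (x : primal) : R := \sum_i cost (agent x i).

Lemma total_cost_convex : exists2 mu, 0 < mu & midpoint_convex mu total_cost.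
Proof.
pose Q i mu := midpoint_convex mu (@cost d T R P N K M i).
have [||mu mu0 muP] := @finite_lower_bound _ _ Q.
- move=> i; have [|mu mu0 h] := @midpoint_convex_sum R _
    (fun r : 'I_(local_dim K M i) => slot_cost i (enum_val r)).
    by move=> r; have [] := slot_cost_admissible r.
  by exists mu => // x y; rewrite !cost_separable; exact: h.
- move=> i mu nu numu h x y; apply: (le_trans (h x y)).
  by have := dotvv_ge0 (x - y); nra.
exists mu => // x y.
rewrite -[X in dotv _ X](submxcolK (x - y)) dotv_mxcol mulr_sumr.
rewrite -big_split mulr_suml -sumrB/=.
apply: ler_sum => i _; have := muP i (agent x i) (agent y i).
have -> : agent (2^-1 *: (x + y)) i = 2^-1 *: (agent x i + agent y i).
  by apply/matrixP => r c; rewrite !mxE.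
by rewrite submxcolB.
Qed.

(** Blocks are ordered as [lam] and [zeta] read them from a dual vector. *)
Definition constraint_fun (x : primal) : dualv :=
  \mxcol_i col_mx (Amx K M i *m agent x i) (coupling (agent x) i).

Definition constraint_mx := matrix_of constraint_fun.

Definition constraint_rhs : dualv := \mxcol_i col_mx (avec K M i) (bvec K M i).

Lemma constraint_residual (x : primal) :
  constraint_mx *m x - constraint_rhs =
  \mxcol_i col_mx (Amx K M i *m agent x i - avec K M i)
                  (coupling (agent x) i - bvec K M i).
Proof.
rewrite matrix_ofE => [|c y z].
  by rewrite -mxcolB; apply: eq_mxcol => i; rewrite opp_col_mx add_col_mx.
apply/mxcolP => i; rewrite submxcolD mxcolK.
have -> : submxcol (c *: constraint_fun y) i = c *: submxcol (constraint_fun y) i.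
  by apply/matrixP => r k; rewrite !mxE.
rewrite !mxcolK scale_col_mx add_col_mx.
have aE j : agent (c *: y + z) j = c *: agent y j + agent z j.
  by apply/matrixP => r k; rewrite !mxE.
rewrite aE mulmxDr scalemxAr; congr col_mx.
rewrite /coupling aE mulmxDr scalerDr scaler_sumr -scalemxAr addrACA -big_split.
by congr (_ + _); apply: eq_bigr => j _; rewrite aE mulmxDr scalemxAr.
Qed.

Lemma lagrangianE (x : primal) (eta : dualv) :
  lagrangian x eta = total_cost x + dotv eta (constraint_mx *m x - constraint_rhs).
Proof.
rewrite constraint_residual dotv_mxcol -big_split /=.
by apply: eq_bigr => i _; rewrite dotv_col_mx addrA.
Qed.

(** Coupling terms are regrouped from the agent owning the multiplier to the agent owning the
    variables; symmetry of [edge] matches the two index sets. The subtracted sum does not depend on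
    [x], so minimization splits over agents. *)
Lemma lagrangian_local (x : primal) (eta : dualv) : symmetric (edge M) ->
  lagrangian x eta = \sum_i local_objective eta (agent x i)
    - \sum_i (dotv (lam eta i) (avec K M i) + dotv (zeta eta i) (bvec K M i)).
Proof.
move=> esym.
have -> : \sum_i local_objective eta (agent x i) =
  \sum_i (cost (agent x i) + dotv (lam eta i) (Amx K M i *m agent x i)
    + dotv (zeta eta i) (Bii K M i *m agent x i))
  + \sum_i \sum_(j | edge M i j) dotv (zeta eta j) (Defs.Bij K M i j *m agent x i).
  rewrite -big_split; apply: eq_bigr => i _ /=.
  rewrite /local_objective !dotvDl !dotv_tr.
  rewrite (big_morph (fun u => dotv u (agent x i)) (fun u v => dotvDl u v _)
    (id1 := 0)); last first.
    by rewrite dotvC dotv0r.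
  rewrite -!addrA; do 3!congr (_ + _).
  by apply: eq_bigr => j _; rewrite dotv_tr.
rewrite (exchange_big_dep xpredT)//= -big_split -sumrB /=.
apply: eq_bigr => i _; rewrite /coupling !dotvBr dotvDr.
rewrite (big_morph (dotv (zeta eta i)) (dotvDr _) (dotv0r _)).
under [in RHS]eq_bigl do rewrite esym.
by ring.
Qed.

Lemma lagrangian_argmin (eta : dualv) (x : forall i, local i) :
  symmetric (edge M) -> (forall i, is_argmin (local_objective eta (i := i)) (x i)) ->
  is_argmin (fun y => total_cost y + dotv eta (constraint_mx *m y - constraint_rhs))
    (\mxcol_i x i).
Proof.
move=> esym xP y; rewrite -!lagrangianE !lagrangian_local// lerD2r.
by apply: ler_sum => i _; rewrite /agent mxcolK; exact: xP.
Qed.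

Lemma dual_functionE :
  dual_function K M = dual total_cost constraint_mx constraint_rhs.
Proof.
apply/funext => u; rewrite /dual_function /dual.
have -> // : (@lagrangian _ _ _ _ _ K M)^~ u =
    (fun y => total_cost y + dotv u (constraint_mx *m y - constraint_rhs)).
by apply/funext => y; exact: lagrangianE.
Qed.

Lemma strictly_feasible_residual (x : primal) k :
  strictly_feasible x -> (constraint_mx *m x - constraint_rhs) k 0 < 0.
Proof.
move=> [xq xb]; rewrite constraint_residual mxE.
(* A global row is an agent [i] with one of its rows [l], either local or a balance row. *)
move: (tagnat.sig1 k) (tagnat.sig2 k) => i l.
rewrite mxE; case: splitP => j _.
- rewrite Amx_mulE mxE; case: (enum_val j) (enum_valP j) => up q.
  by rewrite inE /= => /xq /andP[]; case: up => *; rewrite subr_lt0.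
- suff -> : (coupling (agent x) i - bvec K M i) j 0 =
      robust_demand M i j - balance x i j.
    by rewrite subr_lt0.
  rewrite /coupling Bii_mulE !mxE summxE.
  have -> : \sum_(h | edge M i h) (Defs.Bij K M h i *m agent x h) j 0 =
      - \sum_(h | edge M i h) flow (agent x h) i j.
    by rewrite -sumrN; apply: eq_bigr => h _; rewrite Bij_mulE mxE.
  by rewrite /balance sumrB; ring.
Qed.

End MicrogridDual.

(** * Convergence of the distributed iteration *)

Theorem theorem1 (d : measure_display) (T : measurableType d) (R : realType)
    (P : probability T R) (N K : nat) (M : microgrid P N)
    (K_gt1 : (1 < K)%N)
    (M_wf : well_formed K M)
    (M_costs : admissible_costs M)
    (M_slater : exists x : 'cV[R]_(primal_dim K M), strictly_feasible x)
    (L : R) (L_gt0 : 0 < L)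
    (L_lipschitz : forall eta eta' : 'cV[R]_(dual_dim K M),
        norm2 (grad (dual_function K M) eta - grad (dual_function K M) eta')
        <= L * norm2 (eta - eta'))
    (eta : nat -> 'cV[R]_(dual_dim K M))
    (x : nat -> forall i : 'I_N, 'cV[R]_(local_dim K M i))
    (x_argmin : forall s i, is_argmin (local_objective (eta s) (i := i)) (x s i))
    (lam_step : forall s i, lam (eta s.+1) i =
        posv (lam (eta s) i + L^-1 *: (Amx K M i *m x s i - avec K M i)))
    (zeta_step : forall s i, zeta (eta s.+1) i =
        posv (zeta (eta s) i + L^-1 *: (coupling (x s) i - bvec K M i))) :
  exists2 eta_opt : 'cV[R]_(dual_dim K M),
    dual_optimal eta_opt & eta s @[s --> \oo] --> eta_opt.
Proof.
have esym := edge_sym M_wf.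
have [mu mu0 mu_convex] := total_cost_convex K M_costs.
have [x0 x0P] := M_slater.
rewrite /dual_optimal dual_functionE.
apply: (dual_ascent_cvg mu0 mu_convex _ _ L_gt0 (x0 := x0)
  (x := fun s => \mxcol_i x s i)).
- move=> u; have xex := local_objective_argmin M_costs u.
  exists (\mxcol_i sval (cid (xex i))).
  by apply: lagrangian_argmin => // i; case: cid.
- by move=> k; exact: strictly_feasible_residual.
- by move=> u v; rewrite -dual_functionE; exact: L_lipschitz.
- by move=> s; exact: lagrangian_argmin.
(* Since [posv] acts entrywise, the updates of all agents stack into one projected step. *)
move=> s; rewrite constraint_residual; apply/mxcolP => i.
rewrite -[LHS]vsubmxK -/(lam _ i) -/(zeta _ i) lam_step zeta_step.
have agentE : agent (\mxcol_i x s i) = x s.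
  by apply: functional_extensionality_dep => j; exact: mxcolK.
rewrite submxcol_posv_step agentE -map_col_mx.
by rewrite scale_col_mx -[submxcol (eta s) i]vsubmxK add_col_mx.
Qed.
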